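(* Let $h(\mathbf t)$ be the total number of objects available, and let $J(\mathbf t)\subseteq N$ denote the set of agents that can receive an object, both of which can depend on the realized type profile $\mathbf t$. There is a feasible allocation rule $p=(p_i)_{i\in N}$ inducing an interim allocation rule $P=(P_i)_{i\in N}$ if and only if, for all sets $E=\bigsqcup_{i\in N}E_i$, where each $E_i$ is a Borel subset of $T_i$, $$\sum_{i}\int_{E_i}P_i(t)\,dF_i(t)\ \le\ \int\min\{|J(\mathbf t)\cap I(\mathbf t,E)|,\,h(\mathbf t)\}\,d\mathbf F(\mathbf t).$$
   Context: $N=\{1,\dots,n\}$ is the set of agents; agent $i$'s type $t_i\in T_i=[0,1]$ has cdf $F_i$, and types are independent across agents; $\mathbf t=(t_1,\dots,t_n)$, $\mathbf t_{-i}$ omits the $i$-th coordinate, and $\mathbf F$ denotes the joint (product) distribution on $\prod_iT_i$. An allocation rule $p=(p_i)_{i\in N}:\prod_iT_i\to[0,1]^n$ is feasible if, for all $\mathbf t$, $\sum_ip_i(\mathbf t)\le h(\mathbf t)$, and $p_i(\mathbf t)>0$ implies $i\in J(\mathbf t)$. An interim allocation rule is a profile of functions $P_i:T_i\to[0,1]$; it is induced by $p$ if, for each $i\in N$, $P_i(t)=\mathbb E_{\mathbf t_{-i}}[p_i(t,\mathbf t_{-i})]$ for each $t\in T_i$. The symbol $\bigsqcup$ denotes disjoint union (each element is indexed by the set it comes from), and $I(\mathbf t,E)=\{i\in N: t_i\in E_i\}$ is the set of agents whose types lie in $E$.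
   Formalization: ''Inducing'' is required for F_i-almost every type t rather than for each t in T_i, since otherwise the ''if'' part fails (n=1, F uniform, h=0, P_1 the indicator of {0}); h, J, p and P are taken Borel measurable. *)

(* Defs.v *)
From HB Require Import structures.
From mathcomp Require Import all_boot all_order all_algebra.
From mathcomp Require Import all_classical all_reals all_analysis.

Set Implicit Arguments.
Unset Strict Implicit.
Unset Printing Implicit Defensive.

Import Order.TTheory GRing.Theory Num.Theory.
Import numFieldNormedType.Exports.

Local Open Scope classical_set_scope.
Local Open Scope ring_scope.

Section product_law.
Context d (T : measurableType d) (R : realType).

Definition tuple_cons n (x : T * n.-tuple T) : n.+1.-tuple T :=
  [tuple of x.1 :: x.2].

Lemma measurable_tuple_cons n : measurable_fun setT (@tuple_cons n).
Proof. exact: measurable_cons measurable_fst measurable_snd. Qed.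

HB.instance Definition _ n :=
  @isMeasurableFun.Build _ _ _ _ (@tuple_cons n) (@measurable_tuple_cons n).

Fixpoint product_law n : ('I_n -> probability T R) -> probability (n.-tuple T) R :=
  match n with
  | 0 => fun=> \d_[tuple]
  | m.+1 => fun mu =>
      distribution (mu ord0 \x product_law (fun i => mu (lift ord0 i)))%E
        (@tuple_cons m)
  end.

Definition box n (A : 'I_n -> set T) : set (n.-tuple T) :=
  [set t | forall i, A i (tnth t i)].

(* The characteristic property of the product law. *)
Lemma product_law_box n (mu : 'I_n -> probability T R) (A : 'I_n -> set T) :
  (forall i, measurable (A i)) ->
  product_law mu (box A) = (\prod_(i < n) mu i (A i))%E.
Proof.
elim: n mu A => [|n IHn] mu A mA.
  rewrite big_ord0 /= diracE mem_set//.
  by case.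
have mbox : measurable (box (fun i => A (lift ord0 i))).
  rewrite (_ : box _ = \bigcap_(i in [set: 'I_n])
      ((fun t => tnth t i) @^-1` A (lift ord0 i))); last first.
    by apply/seteqP; split=> t /= + i => /(_ i) //; exact.
  apply: fin_bigcap_measurable => // i _.
  by rewrite -[X in measurable X]setTI; exact: measurable_tnth.
rewrite big_ord_recl /= -IHn//.
rewrite /distribution /pushforward -product_measure1E//; congr (_ _).
apply/seteqP; split=> [[x s]/= xs|[x s]/= [Ax As] i].
  split=> [|i]; first exact: (xs ord0).
  by have := xs (lift ord0 i); rewrite /tuple_cons tnthS.
have [j ->|->] := unliftP ord0 i; last exact: Ax.
by rewrite /tuple_cons tnthS; exact: As.
Qed.

End product_law.

Section allocation.
Context (R : realType) (n : nat).
Local Notation profile := (n.-tuple (measurableTypeR R)).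

(* Types live in [0, 1], seen as a subset of R: functions of types are total on
   R (or R^n) and only their restrictions to [0, 1] (or [0, 1]^n) matter. *)
Definition type_space : set (measurableTypeR R) := `[0, 1]%classic.

Definition profile_space : set profile := box (fun=> type_space).

(* F is the cdf of a probability distribution concentrated on [0, 1]. *)
Definition type_cdf (F : cumulativeBounded (0 : R) (1 : R)) : Prop :=
  (forall x, x < 0 -> F x = 0) /\ F 1 = 1.

Definition type_law (F : cumulativeBounded (0 : R) (1 : R)) :
  probability (measurableTypeR R) R := lebesgue_stieltjes_measure F.

Definition joint_law (F : 'I_n -> cumulativeBounded (0 : R) (1 : R)) :
  probability profile R := product_law (fun i => type_law (F i)).

Definition agents_in (E : 'I_n -> set (measurableTypeR R)) (t : profile) :
  {set 'I_n} := finset (fun i => tnth t i \in E i).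

Definition replace_type (t : profile) (i : 'I_n) (x : measurableTypeR R) :
  profile := [tuple (if j == i then x else tnth t j) | j < n].

Definition allocation_rule (p : 'I_n -> profile -> R) : Prop :=
  forall i, measurable_fun profile_space (p i) /\
            (forall t, profile_space t -> 0 <= p i t <= 1).

Definition feasible (h : profile -> nat) (J : profile -> {set 'I_n})
    (p : 'I_n -> profile -> R) : Prop :=
  forall t, profile_space t ->
    \sum_(i < n) p i t <= (h t)%:R /\ (forall i, 0 < p i t -> i \in J t).

Definition interim_rule (P : 'I_n -> measurableTypeR R -> R) : Prop :=
  forall i, measurable_fun type_space (P i) /\
            (forall x, type_space x -> 0 <= P i x <= 1).

(* The integrand does not depend on the i-th coordinate of t, so integrating
   against the joint law is the expectation over the types of the agents other
   than i. *)
Definition interim_expectation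
    (F : 'I_n -> cumulativeBounded (0 : R) (1 : R))
    (p : 'I_n -> profile -> R) (i : 'I_n) (x : measurableTypeR R) : \bar R :=
  (\int[joint_law F]_(t in profile_space) (p i (replace_type t i x))%:E)%E.

(* P i and the expectation are compared for F i-almost every type: changing P i
   on an F i-null set affects none of the integrals of P i, so these determine
   P i only up to such sets. *)
Definition induces (F : 'I_n -> cumulativeBounded (0 : R) (1 : R))
    (p : 'I_n -> profile -> R) (P : 'I_n -> measurableTypeR R -> R) : Prop :=
  forall i, {ae type_law (F i), forall x, type_space x ->
    (P i x)%:E = interim_expectation F p i x}.

End allocation.

Arguments type_space : clear implicits.
Arguments profile_space : clear implicits.

(* Main.v *)
Require Import Defs.
From HB Require Import structures.
From mathcomp Require Import all_boot all_order all_algebra.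
From mathcomp Require Import all_classical all_reals all_analysis.
From mathcomp Require Import measurable_realfun ring lra.

Set Implicit Arguments.
Unset Strict Implicit.
Unset Printing Implicit Defensive.

Import Order.TTheory GRing.Theory Num.Theory.
Import numFieldNormedType.Exports.

Local Open Scope classical_set_scope.
Local Open Scope ring_scope.

(* Necessity is Fubini's theorem. For sufficiency, among the allocations within
   the capacities choose one minimizing the total squared L2 distance between its
   interim rule and P. The infimum is attained: approximate minimizers of almost
   least norm are L2-Cauchy by the parallelogram identity, so no weak compactness
   is needed. Let c_i be the gap P_i minus the optimal interim rule, and let
   E_i = {c_i > 0}. By the first-order optimality condition the optimal allocation
   gives min(|J & I(t, E)|, h) units to I(t, E) for almost every t: otherwise one
   would gain by taking everything from the agents outside I(t, E) and raising the
   agents inside it. The inequality for E then says that the integrals of the c_i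
   over E_i sum to at most 0, so the optimal interim rule dominates P almost
   everywhere, and scaling it down agent by agent yields P. *)

(** * Approximate minimizers forming a Cauchy family *)

(** Think of [N] as a squared norm and [d] as a squared distance. As the tolerance shrinks, the
    least [N] among the approximate minimizers of [f] grows but stays below [B]. Two approximate
    minimizers with [N] close to the limiting value have a midpoint whose [N] cannot be much
    smaller, and the parallelogram identity then forces them to be close. *)
Lemma uniform_approx_minimizers (R : realType) (V : Type) (K : set V)
    (mid : V -> V -> V) (f N : V -> R) (d : V -> V -> R) (B : R) :
  K !=set0 -> (forall p q, K p -> K q -> K (mid p q)) ->
  (forall p, K p -> 0 <= f p) -> (forall p, K p -> 0 <= N p <= B) ->
  (forall p q, K p -> K q -> f (mid p q) <= (f p + f q) / 2) ->
  (forall p q, K p -> K q -> N (mid p q) = (N p + N q) / 2 - d p q / 4) ->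
  exists m : R -> V, forall e, 0 < e ->
    [/\ K (m e), forall q, K q -> f (m e) <= f q + e &
        forall e', 0 < e' -> d (m e) (m e') <= 8 * Num.max e e'].
Proof.
move=> [p0 Kp0] Kmid f0 NB fmid Nmid.
pose S e := [set p | K p /\ forall q, K q -> f p <= f q + e].
have S_neq0 e : 0 < e -> S e !=set0.
  move=> e0; have hf : has_inf (f @` K).
    split; first by exists (f p0), p0.
    by exists 0 => _ [p Kp <-]; exact: f0.
  have [_ [p Kp <-] fp] := inf_adherent e0 hf.
  exists p; split=> // q Kq; apply: le_trans (ltW fp) _; rewrite lerD2r.
  by apply: ge_inf; [exact: hf.2 | exists q].
have S_sub e e' : e <= e' -> S e `<=` S e'.
  by move=> ee' p [Kp fp]; split=> // q /fp /le_trans; apply; rewrite lerD2l.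
have S_mid e p q : S e p -> S e q -> S e (mid p q).
  move=> [Kp fp] [Kq fq]; split=> [|r Kr]; first exact: Kmid.
  have := fmid _ _ Kp Kq; have := fp _ Kr; have := fq _ Kr; lra.
have hN e : 0 < e -> has_inf (N @` S e).
  move=> e0; have [p Sp] := S_neq0 _ e0.
  split; first by exists (N p), p.
  by exists 0 => _ [q [Kq _] <-]; have /andP[] := NB _ Kq.
pose a e := inf (N @` S e).
have a_le e p : 0 < e -> S e p -> a e <= N p.
  by move=> e0 Sp; apply: ge_inf; [exact: (hN _ e0).2 | exists p].
have a_mono e e' : 0 < e -> e <= e' -> a e' <= a e.
  move=> e0 ee'; apply: lb_le_inf; first exact: (hN _ e0).1.
  move=> _ [p Sp <-]; apply: a_le; first exact: lt_le_trans ee'.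
  exact: S_sub Sp.
pose A := [set a e | e in [set e | 0 < e]].
have hA : has_sup A.
  split; first by exists (a 1), 1 => //=.
  exists B => _ [e e0 <-]; have [p Sp] := S_neq0 _ e0.
  by rewrite (le_trans (a_le _ _ e0 Sp))//; have /NB/andP[] := Sp.1.
have a_sup e : 0 < e -> a e <= sup A.
  by move=> e0; apply: ub_le_sup; [exact: hA.2 | exists e].
(* The second component is an auxiliary tolerance at which [a] is already within [e] of its
   supremum. The chosen point minimizes [f] up to both tolerances. *)
have pick e : exists pe : V * R, 0 < e -> [/\ S e pe.1, S pe.2 pe.1, 0 < pe.2,
    sup A - e < a pe.2 & N pe.1 <= sup A + e].
  have [e0|e0] := ltP 0 e; last by exists (p0, e).
  have [_ [e1 e10 <-] supA] := sup_adherent e0 hA.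
  have m0 : 0 < Num.min e e1 by rewrite lt_min e0.
  have [_ [p Sp <-] Np] := inf_adherent e0 (hN _ m0).
  exists (p, e1) => _; split=> //=.
  - by apply: S_sub Sp; rewrite ge_min lexx.
  - by apply: S_sub Sp; rewrite ge_min lexx orbT.
  - by rewrite (le_trans (ltW Np))// lerD2r a_sup.
have [m hm] := choice pick.
exists (fun e => (m e).1) => e e0.
have [Se Sm m0 ma mN] := hm _ e0; split; [exact: Se.1|exact: Se.2|].
move=> e' e'0; have [_ Sm' m'0 ma' mN'] := hm _ e'0.
(* The midpoint is an approximate minimizer for the larger of the two auxiliary tolerances, where
   [a] is still close to its supremum. *)
have mid_ge : sup A - Num.max e e' <= N (mid (m e).1 (m e').1).
  have [mm'|/ltW mm'] := leP (m e).2 (m e').2.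
    apply: (@le_trans _ _ (a (m e').2)).
      by rewrite (le_trans _ (ltW ma'))// lerD2l lerN2 le_max lexx orbT.
    by apply: a_le => //; apply: S_mid => //; exact: S_sub Sm.
  apply: (@le_trans _ _ (a (m e).2)).
    by rewrite (le_trans _ (ltW ma))// lerD2l lerN2 le_max lexx.
  by apply: a_le => //; apply: S_mid => //; exact: S_sub Sm'.
(* Both endpoints have [N] at most [sup A + Num.max e e'] and the midpoint at least
   [sup A - Num.max e e'], so a quarter of [d] is at most twice the maximum; hence the factor 8. *)
move: mid_ge; rewrite (Nmid _ _ Sm.1 Sm'.1).
have : e <= Num.max e e' by rewrite le_max lexx.
have : e' <= Num.max e e' by rewrite le_max lexx orbT.
lra.
Qed.

(** * Bounded measurable functions and their integrals *)

Section bounded_measurable.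
Context d (X : measurableType d) (R : realType).
Implicit Types u v : X -> R.

(** The bound holds everywhere, not almost everywhere, so the property mentions no measure: it gives
    integrability under every probability and survives composition with measurable maps. *)
Definition bounded_measurable u :=
  measurable_fun setT u /\ exists M : R, forall x, `|u x| <= M.

Lemma bounded_measurable_cst (c : R) : bounded_measurable (fun=> c).
Proof. by split; [exact: measurable_cst|exists `|c|]. Qed.

Lemma bounded_measurable01 u :
  measurable_fun setT u -> (forall x, 0 <= u x <= 1) -> bounded_measurable u.
Proof.
move=> mu u01; split=> //; exists 1 => x.
by have /andP[u0 u1] := u01 x; rewrite ger0_norm.
Qed.

Lemma bounded_measurableD u v : bounded_measurable u -> bounded_measurable v ->
  bounded_measurable (fun x => u x + v x).
Proof.
move=> [mu [M uM]] [mv [M' vM]]; split; first exact: measurable_funD.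
by exists (M + M') => x; rewrite (le_trans (ler_normD _ _))// lerD.
Qed.

Lemma bounded_measurableM u v : bounded_measurable u -> bounded_measurable v ->
  bounded_measurable (fun x => u x * v x).
Proof.
move=> [mu [M uM]] [mv [M' vM]]; split; first exact: measurable_funM.
by exists (M * M') => x; rewrite normrM ler_pM.
Qed.

Lemma bounded_measurableB u v : bounded_measurable u -> bounded_measurable v ->
  bounded_measurable (fun x => u x - v x).
Proof.
move=> [mu [M uM]] [mv [M' vM]]; split; first exact: measurable_funB.
by exists (M + M') => x; rewrite (le_trans (ler_normB _ _))// lerD.
Qed.

Lemma bounded_measurable_norm u :
  bounded_measurable u -> bounded_measurable (fun x => `|u x|).
Proof.
move=> [mu [M uM]]; split; first exact: measurableT_comp.
by exists M => x; rewrite normr_id.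
Qed.

Lemma bounded_measurable_indic (A : set X) :
  measurable A -> bounded_measurable (\1_A).
Proof.
move=> mA; apply: bounded_measurable01; first exact: measurable_indic.
by move=> x; rewrite indicE; case: (_ \in _) => /=; rewrite lexx ler01.
Qed.

Lemma bounded_measurable_sum n (u : 'I_n -> X -> R) :
  (forall i, bounded_measurable (u i)) ->
  bounded_measurable (fun x => \sum_i u i x).
Proof.
move=> bu; elim: (index_enum _) => [|i s IHs].
  by under eq_fun do rewrite big_nil; exact: bounded_measurable_cst.
by under eq_fun do rewrite big_cons; exact: bounded_measurableD.
Qed.

Variable P : probability X R.

Lemma bounded_measurable_integrable u :
  bounded_measurable u -> P.-integrable setT (EFin \o u).
Proof.
move=> [mu [M uM]]; apply: measurable_bounded_integrable; [by []| |by []|].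
  by rewrite (le_lt_trans (probability_le1 P measurableT)) ?ltry.
exists M; split; first exact: num_real.
by move=> M' MM' x _; exact: le_trans (uM x) (ltW MM').
Qed.
Let bm_int := bounded_measurable_integrable.

Lemma integral_bounded_measurable u : bounded_measurable u ->
  (\int[P]_x (u x)%:E)%E = (\int[P]_x u x)%:E.
Proof.
move=> bu; rewrite /Rintegral fineK//.
by apply: integrable_fin_num => //; exact: bm_int.
Qed.

Lemma Rintegral_sum n (u : 'I_n -> X -> R) :
  (forall i, bounded_measurable (u i)) ->
  \int[P]_x (\sum_i u i x) = \sum_i \int[P]_x u i x.
Proof.
move=> bu; apply: EFin_inj.
rewrite -integral_bounded_measurable; last exact: bounded_measurable_sum.
under eq_integral do rewrite -sumEFin.
rewrite integral_sum//; last by move=> i; exact: bm_int (bu i).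
under eq_bigr do rewrite integral_bounded_measurable//.
by rewrite sumEFin.
Qed.

Lemma Rintegral_le0_ae_eq0 u : bounded_measurable u -> (forall x, 0 <= u x) ->
  \int[P]_x u x <= 0 -> {ae P, forall x, u x = 0}.
Proof.
move=> bu u0 Iu.
have mu : measurable_fun setT (EFin \o u) by apply/measurable_EFinP; exact: bu.1.
have /(ae_eq_integral_abs P measurableT mu) :
    (\int[P]_x `|(EFin \o u) x| = 0)%E.
  under eq_integral => x _ do rewrite /= ger0_norm ?u0//.
  rewrite integral_bounded_measurable//; congr _%:E.
  by apply/eqP; rewrite eq_le Iu Rintegral_ge0.
by apply: filterS => x /(_ I) [].
Qed.

Lemma ae_eq_Rintegral u v : bounded_measurable u -> bounded_measurable v ->
  {ae P, forall x, u x = v x} -> \int[P]_x u x = \int[P]_x v x.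
Proof.
move=> [mu _] [mv _] uv; congr fine; apply: ae_eq_integral => //.
- exact/measurable_EFinP.
- exact/measurable_EFinP.
- by apply: filterS uv => x -> _.
Qed.

End bounded_measurable.

Lemma bounded_measurable_comp d d' (X : measurableType d) (Y : measurableType d')
    (R : realType) (f : Y -> X) (u : X -> R) :
  measurable_fun setT f -> bounded_measurable u -> bounded_measurable (u \o f).
Proof.
by move=> mf [mu [M uM]]; split; [exact: measurableT_comp|exists M => y /=].
Qed.

(** * Almost everywhere convergence from summable L1 increments *)

(** The sum [g] of the absolute increments has finite integral, hence is finite almost everywhere;
    there the telescoping series converges absolutely. *)
Lemma ae_cvg_of_summable_L1 d (X : measurableType d) (R : realType)
    (P : {measure set X -> \bar R}) (u : nat -> X -> R) :
  (forall k, measurable_fun setT (u k)) ->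
  (\sum_(k <oo) \int[P]_x `|u k.+1 x - u k x|%:E < +oo)%E ->
  {ae P, forall x, cvgn (u ^~ x)}.
Proof.
move=> mu ufin.
pose g x : \bar R := (\sum_(k <oo) `|u k.+1 x - u k x|%:E)%E.
have mt k : measurable_fun setT (fun x => `|u k.+1 x - u k x|%:E).
  by apply/measurable_EFinP/measurableT_comp => //; exact: measurable_funB.
have ig : P.-integrable setT g.
  apply/integrableP; split.
    by apply: ge0_emeasurable_sum.
  rewrite (eq_integral g); first by rewrite integral_nneseries.
  by move=> x _; rewrite gee0_abs// nneseries_ge0.
apply: filterS (integrable_ae measurableT ig) => x /(_ I) gx.
have : cvgn [normed series (telescope (u ^~ x))].
  apply: nondecreasing_is_cvgn.
    by apply: nondecreasing_series => k _ /=.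
  exists (fine (g x)) => _ [k _ <-] /=.
  rewrite -lee_fin fineK// /series/= -sumEFin.
  by apply: nneseries_lim_ge => j _ /=.
move=> /normed_cvg cvg_telescope.
rewrite (_ : u ^~ x = fun n => u 0%N x + series (telescope (u ^~ x)) n).
  by apply: is_cvgD => //; exact: is_cvg_cst.
by apply/funext => n; rewrite -(eq_sum_telescope (u ^~ x)).
Qed.

(** * Redrawing the type of one agent, and interim expectations *)

Section resample.
Context d (T : measurableType d) (R : realType) (n : nat).
Variable mu : 'I_n -> probability T R.
Local Notation profile := (n.-tuple T).
Implicit Types (u w : profile -> R) (v : T -> R).

(** On real types this is the same tuple as [replace_type], here over an arbitrary measurable type
    space. *)
Definition resample (t : profile) (i : 'I_n) (x : T) : profile :=
  [tuple (if j == i then x else tnth t j) | j < n].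

Lemma tnth_resample t i x : tnth (resample t i x) i = x.
Proof. by rewrite tnth_mktuple eqxx. Qed.

Lemma measurable_resample i :
  measurable_fun setT (fun z : T * profile => resample z.2 i z.1).
Proof.
apply/measurable_fun_tnthP => j.
rewrite (_ : _ \o _ = fun z : T * profile => if j == i then z.1 else tnth z.2 j).
  case: (j == i); first exact: measurable_fst.
  exact: (measurableT_comp (@measurable_tnth _ T n j) measurable_snd).
by apply/funext => z /=; rewrite tnth_mktuple.
Qed.

Lemma measurable_resampler i x :
  measurable_fun setT (fun t : profile => resample t i x).
Proof.
exact: (measurableT_comp (measurable_resample i) (measurable_pair1 x)).
Qed.

Definition boxes : set (set profile) :=
  [set box A | A in [set A : 'I_n -> set T | forall i, measurable (A i)]].

Lemma measurable_box (A : 'I_n -> set T) :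
  (forall i, measurable (A i)) -> measurable (box A : set profile).
Proof.
move=> mA.
rewrite (_ : box _ = \bigcap_(i in [set: 'I_n])
    ((fun t => tnth t i) @^-1` A i)); last first.
  by apply/seteqP; split=> t /= + i => /(_ i) //; exact.
apply: fin_bigcap_measurable => // i _.
by rewrite -[X in measurable X]setTI; exact: measurable_tnth.
Qed.

(** A coordinate cylinder is a box with full sides elsewhere, so cylinders and boxes generate the
    same sigma-algebra. Boxes are moreover stable under intersection, as uniqueness of measures
    demands. *)
Lemma measurable_tuple_boxes : (measurable : set (set profile)) = <<s boxes >>.
Proof.
apply/seteqP; split; last first.
  apply: smallest_sub; first exact: sigma_algebra_measurable.
  by move=> _ [A mA <-]; exact: measurable_box.
apply: smallest_sub; first exact: smallest_sigma_algebra.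
rewrite -bigcup_seq => B [i _ [C mC <-]]; apply: sub_sigma_algebra.
exists (fun j => if j == i then C else setT); first by move=> j; case: ifP.
apply/seteqP; split=> t /=.
  by move=> /(_ i); rewrite eqxx.
by move=> [_ Ct] j; case: eqP => [->|].
Qed.

(** By independence, an independent redraw of coordinate [i] from [mu i] does not change the law.
    Both measures are finite, so they need only be compared on boxes. *)
Lemma product_law_resample i (A : set profile) : measurable A ->
  product_law mu A = (mu i \x product_law mu)%E
    ((fun z : T * profile => resample z.2 i z.1) @^-1` A).
Proof.
move=> mA; pose phi := fun z : T * profile => resample z.2 i z.1.
have mphi := measurable_resample i.
apply: (@measure_unique _ _ _ boxes (fun=> setT) measurable_tuple_boxes _ _ _
  (product_law mu) (pushforward (mu i \x product_law mu)%E phi)) => //.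
- move=> _ _ [B mB <-] [C mC <-]; exists (fun i => B i `&` C i).
    by move=> j; exact: measurableI.
  apply/seteqP; split=> [t BC|t [Bt Ct] j]; last by split; [exact: Bt|exact: Ct].
  by split=> j; have [] := BC j.
- move=> k; exists (fun=> setT) => //.
  by apply/seteqP; split.
- by rewrite bigcup_const//; exists 0%N.
- move=> _ [B mB <-].
  (* The preimage of a box is a rectangle: side [i] constrains the fresh type, and the overwritten
     coordinate becomes free. *)
  rewrite [RHS](_ : _ = (mu i \x product_law mu)%E
      (B i `*` box (fun j => if j == i then setT else B j))).
    rewrite product_measure1E//; last first.
      by apply: measurable_box => j; case: ifP.
    transitivity (\prod_(j < n) mu j (B j))%E; first exact: product_law_box.
    transitivity (mu i (B i) * \prod_(j < n) mu j (if j == i then setT else B j))%E.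
      rewrite (bigD1 i)//= [X in (_ = _ * X)%E](bigD1 i)//= eqxx.
      rewrite probability_setT mul1e; congr (_ * _)%E.
      by apply: eq_bigr => j /negPf ->.
    congr (_ * _)%E; apply/esym/product_law_box => j.
    by case: ifP.
  congr ((mu i \x product_law mu)%E _).
  apply/seteqP; split=> [[x t] /= Bt|[x t] /= [Bx Bt] j].
    split=> [|j]; first by have := Bt i; rewrite tnth_resample.
    by case: eqP => // /eqP ji; have := Bt j; rewrite tnth_mktuple (negPf ji).
  rewrite tnth_mktuple; case: eqP => [->//|/eqP ji].
  by have := Bt j; rewrite (negPf ji).
- by move=> k; rewrite (le_lt_trans (probability_le1 _ measurableT)) ?ltry.
Qed.

Lemma Rintegral_resample i (u : profile -> R) : bounded_measurable u ->
  \int[product_law mu]_t u t =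
  \int[mu i]_x \int[product_law mu]_t u (resample t i x).
Proof.
move=> bu; pose phi := fun z : T * profile => resample z.2 i z.1.
have mphi : measurable_fun setT phi := measurable_resample i.
have bphi : bounded_measurable (u \o phi) := bounded_measurable_comp mphi bu.
have iphi : (mu i \x product_law mu)%E.-integrable setT (EFin \o (u \o phi)).
  exact: bounded_measurable_integrable.
rewrite /Rintegral; congr fine.
rewrite (eq_measure_integral (pushforward (mu i \x product_law mu)%E phi)); last first.
  by move=> A mA _; exact: product_law_resample.
rewrite (integral_pushforward mphi)//; last by apply/measurable_EFinP; exact: bu.1.
rewrite preimage_setT.
apply: eq_trans (esym (@integral12_prod_meas1 _ _ _ _ _ (mu i) (product_law mu)
  _ iphi)) _.
apply: eq_integral => x _; rewrite /fubini_F/= integral_bounded_measurable//.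
exact: bounded_measurable_comp (measurable_resampler i x) bu.
Qed.

(** The conditional expectation of [u] given type [x] of agent [i]. The integral runs over whole
    profiles, but their [i]-th coordinate is overwritten. *)
Definition interim i (u : profile -> R) (x : T) : R :=
  \int[product_law mu]_t u (resample t i x).

Lemma bounded_measurable_resample i u x : bounded_measurable u ->
  bounded_measurable (fun t => u (resample t i x)).
Proof. exact: bounded_measurable_comp (measurable_resampler i x). Qed.

Lemma bounded_measurable_interim i u :
  bounded_measurable u -> bounded_measurable (interim i u).
Proof.
move=> bu; pose phi := fun z : T * profile => resample z.2 i z.1.
have bphi : bounded_measurable (u \o phi).
  exact: bounded_measurable_comp (measurable_resample i) bu.
have iphi : (mu i \x product_law mu)%E.-integrable setT (EFin \o (u \o phi)).
  exact: bounded_measurable_integrable.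
split.
  apply/measurable_EFinP; apply: eq_measurable_fun
    (@measurable_fubini_F _ _ _ _ _ (mu i) (product_law mu) _ iphi).
  move=> x _; rewrite /fubini_F/= integral_bounded_measurable//.
  exact: bounded_measurable_resample.
have [_ [M uM]] := bu; exists M => x.
have bux := bounded_measurable_resample i x bu.
rewrite (le_trans (le_normr_Rintegral _ (bounded_measurable_integrable _ bux)))//.
rewrite -[leRHS]mulr1 -[X in M * X](_ : fine (product_law mu setT) = 1); last first.
  by rewrite probability_setT.
rewrite -Rintegral_cst//; apply: le_Rintegral => //.
- by apply: bounded_measurable_integrable; exact: bounded_measurable_norm.
- by apply: bounded_measurable_integrable; exact: bounded_measurable_cst.
Qed.

Lemma bounded_measurable_tnth i (v : T -> R) : bounded_measurable v ->
  bounded_measurable (fun t : profile => v (tnth t i)).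
Proof. exact: bounded_measurable_comp (@measurable_tnth _ T n i). Qed.

(** After redrawing coordinate [i], the factor [v] depends on the fresh type alone and leaves the
    inner integral. This passage between ex post and interim quantities serves both directions of
    the theorem. *)
Lemma Rintegral_interim i v u : bounded_measurable v -> bounded_measurable u ->
  \int[product_law mu]_t (v (tnth t i) * u t) = \int[mu i]_x (v x * interim i u x).
Proof.
move=> bv bu; rewrite (Rintegral_resample i); last first.
  by apply: bounded_measurableM => //; exact: bounded_measurable_tnth.
apply: eq_Rintegral => x _; under eq_Rintegral do rewrite tnth_resample.
rewrite RintegralZl//; apply: bounded_measurable_integrable.
exact: bounded_measurable_resample.
Qed.

Lemma interimB i u w x : bounded_measurable u -> bounded_measurable w ->
  interim i (fun t => u t - w t) x = interim i u x - interim i w x.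
Proof.
by move=> bu bw; rewrite /interim RintegralB//;
  apply: bounded_measurable_integrable; exact: bounded_measurable_resample.
Qed.

Lemma interimD i u w x : bounded_measurable u -> bounded_measurable w ->
  interim i (fun t => u t + w t) x = interim i u x + interim i w x.
Proof.
by move=> bu bw; rewrite /interim RintegralD//;
  apply: bounded_measurable_integrable; exact: bounded_measurable_resample.
Qed.

Lemma interimZ i a u x : bounded_measurable u ->
  interim i (fun t => a * u t) x = a * interim i u x.
Proof.
by move=> bu; rewrite /interim RintegralZl//;
  apply: bounded_measurable_integrable; exact: bounded_measurable_resample.
Qed.

Lemma interim_ge0 i u x : (forall t, 0 <= u t) -> 0 <= interim i u x.
Proof. by move=> u0; exact: Rintegral_ge0. Qed.

Lemma interim_le1 i u x : bounded_measurable u -> (forall t, u t <= 1) ->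
  interim i u x <= 1.
Proof.
move=> bu u1; rewrite -[leRHS]mul1r -[X in 1 * X](_ : fine (product_law mu setT) = 1).
  rewrite -Rintegral_cst//; apply: le_Rintegral => //.
    by apply: bounded_measurable_integrable; exact: bounded_measurable_resample.
  by apply: bounded_measurable_integrable; exact: bounded_measurable_cst.
by rewrite probability_setT.
Qed.

Lemma le_norm_interim i u x : bounded_measurable u ->
  `|interim i u x| <= interim i (fun t => `|u t|) x.
Proof.
move=> bu; apply: le_normr_Rintegral => //.
by apply: bounded_measurable_integrable; exact: bounded_measurable_resample.
Qed.

End resample.

(** * Limits of families indexed by the agents *)

(** The index is extended to all naturals, vacuously from [n] on, so that the countable case
    applies. *)
Lemma ae_forall_ord d (X : measurableType d) (R : realType)
    (P : {measure set X -> \bar R}) n (A : 'I_n -> X -> Prop) :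
  (forall i, {ae P, forall x, A i x}) -> {ae P, forall x, forall i, A i x}.
Proof.
move=> aeA.
have : {ae P, forall x, forall k i, val i = k -> A i x}.
  apply: ae_foralln => k; have [kn|nk] := ltnP k n.
    apply: filterS (aeA (Ordinal kn)) => x Ax i ik.
    by rewrite (_ : i = Ordinal kn)//; exact: val_inj.
  by apply: aeW => x i ik; have := ltn_ord i; rewrite [X in (X < _)%N]ik ltnNge nk.
by apply: filterS => x Ax i; exact: (Ax i).
Qed.

(* The limit is set to 0 where the family does not converge, so that closed
   pointwise constraints satisfied by 0 hold everywhere for the limit. *)
Lemma L1_limit d (X : measurableType d) (R : realType) (P : probability X R) n
    (p : nat -> 'I_n -> X -> R) :
  (forall k i, measurable_fun setT (p k i)) ->
  (forall k i t, 0 <= p k i t <= 1) ->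
  (forall i, \sum_(k <oo) \int[P]_t `|p k.+1 i t - p k i t|%:E < +oo)%E ->
  exists p' : 'I_n -> X -> R,
    [/\ forall i, measurable_fun setT (p' i),
        forall t, (forall i, p ^~ i ^~ t @ \oo --> p' i t) \/ (forall i, p' i t = 0) &
        forall i, \int[P]_t `|p k i t - p' i t| @[k --> \oo] --> 0].
Proof.
move=> mp p01 psum.
have [N [mN N0 cvgN]] : {ae P, forall t, forall i, cvgn (p ^~ i ^~ t)}.
  apply: ae_forall_ord => i.
  by apply: (@ae_cvg_of_summable_L1 _ _ _ P (fun k => p k i)).
have cvgp t : t \notin N -> forall i, cvgn (p ^~ i ^~ t).
  by move=> tN; apply: contrapT => /cvgN; rewrite -inE (negPf tN).
pose p' i t := if t \in N then 0 else limn (p ^~ i ^~ t).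
have cvgp' t : t \notin N -> forall i, p ^~ i ^~ t @ \oo --> p' i t.
  by move=> tN i; rewrite /p' (negPf tN); exact: cvgp.
have mp' i : measurable_fun setT (p' i).
  (* Cutting the sequence off on the null set [N] makes it converge to [p'] at every point. *)
  apply: (@measurable_fun_cvg _ _ _ _ (fun k t => p k i t * \1_(~` N) t)).
    by move=> k; apply: measurable_funM => //; exact/measurable_indic/measurableC.
  move=> t _; rewrite indicE in_setC; have [tN|tN] := boolP (t \in N).
    by rewrite /p' tN /=; under eq_fun do rewrite mulr0; exact: cvg_cst.
  by rewrite /=; under eq_fun do rewrite mulr1; exact: cvgp'.
have p'01 i t : 0 <= p' i t <= 1.
  have [tN|tN] := boolP (t \in N); first by rewrite /p' tN lexx ler01.
  have cp := cvgp' _ tN i.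
  rewrite -(cvg_lim _ cp)//; apply/andP; split.
    apply: limr_ge; first by apply: cvgP cp.
    by apply: nearW => k; have /andP[] := p01 k i t.
  apply: limr_le; first by apply: cvgP cp.
  by apply: nearW => k; have /andP[] := p01 k i t.
exists p'; split=> // [t|i].
  have [tN|tN] := boolP (t \in N); last by left; exact: cvgp'.
  by right=> i; rewrite /p' tN.
have mdist k : measurable_fun setT (fun t => `|p k i t - p' i t|).
  by apply: measurableT_comp => //; exact: measurable_funB.
have dist_le1 k t : `|p k i t - p' i t| <= 1.
  rewrite ler_norml; have := p01 k i t; have := p'01 i t; lra.
(* Dominated convergence with the constant 1 as dominating function. *)
have [| | |//| |_ _] := @dominated_convergence _ _ _ P setT measurableT
  (fun k t => `|p k i t - p' i t|%:E) (cst 0%E) (cst 1%E).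
- by move=> k; apply/measurable_EFinP.
- exact: measurable_cst.
- exists N; split=> // t; apply: contra_notP => tN _.
  apply/cvg_EFin; first exact: nearW.
  have cp : p ^~ i ^~ t @ \oo --> p' i t by apply: cvgp'; apply/negP; rewrite inE.
  rewrite -(normr0 R) -(subrr (p' i t)).
  by apply: cvg_norm; apply: cvgB => //; exact: cvg_cst.
- exact: finite_measure_integrable_cst.
- by apply: aeW => t k _; rewrite /= normr_id lee_fin.
by rewrite integral0 => /fine_cvg.
Qed.


Lemma cvg_sum_ord (R : realType) (n : nat) (u : nat -> 'I_n -> R) (l : 'I_n -> R) :
  (forall i, u k i @[k --> \oo] --> l i) ->
  \sum_i u k i @[k --> \oo] --> \sum_i l i.
Proof.
by move=> ul; apply: cvg_big => [|i _]; [exact: add_continuous|exact: ul].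
Qed.

Lemma Rintegral_prob_cst d (X : measurableType d) (R : realType)
    (P : probability X R) (r : R) : \int[P]_x r = r.
Proof.
rewrite Rintegral_cst//.
have -> : fine (P setT) = 1 by rewrite (@probability_setT _ _ _ P).
by rewrite mulr1.
Qed.

Lemma Rintegral_lin d (X : measurableType d) (R : realType) (P : probability X R)
    (a b : R) (u v : X -> R) : bounded_measurable u -> bounded_measurable v ->
  \int[P]_x (a * u x + b * v x) = a * \int[P]_x u x + b * \int[P]_x v x.
Proof.
move=> bu bv.
have bau : bounded_measurable (fun x => a * u x).
  exact: bounded_measurableM (bounded_measurable_cst _ a) bu.
have bbv : bounded_measurable (fun x => b * v x).
  exact: bounded_measurableM (bounded_measurable_cst _ b) bv.
by rewrite RintegralD ?RintegralZl//; exact: bounded_measurable_integrable.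
Qed.

Lemma bounded_measurable_sqr d (X : measurableType d) (R : realType) (u : X -> R) :
  bounded_measurable u -> bounded_measurable (fun x => u x ^+ 2).
Proof. by move=> bu; exact: bounded_measurableM. Qed.

(** * Existence of an allocation whose interim rule is closest to the target *)

Section minimizer.
Context d (T : measurableType d) (R : realType) (n : nat).
Variable mu : 'I_n -> probability T R.
Local Notation profile := (n.-tuple T).
Local Notation P := (product_law mu).
Variables (cap : 'I_n -> profile -> R) (H : profile -> R).
Hypothesis cap01 : forall i t, 0 <= cap i t <= 1.
Hypothesis H0 : forall t, 0 <= H t.
Variable Q : 'I_n -> T -> R.
Hypothesis mQ : forall i, measurable_fun setT (Q i).
Hypothesis Q01 : forall i x, 0 <= Q i x <= 1.

(** In the application [cap i] is the indicator that [i] may receive an object, so the upper bound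
    encodes eligibility, and [H] is the number of objects. *)
Definition allocations : set ('I_n -> profile -> R) :=
  [set p : 'I_n -> profile -> R | [/\ forall i, measurable_fun setT (p i),
               forall i t, 0 <= p i t <= cap i t &
               forall t, \sum_i p i t <= H t]].

Definition interim_gap (p : 'I_n -> profile -> R) : R :=
  \sum_i \int[mu i]_x (interim mu i (p i) x - Q i x) ^+ 2.

Definition mid (p q : 'I_n -> profile -> R) : 'I_n -> profile -> R :=
  fun i t => 2^-1 * p i t + 2^-1 * q i t.

Implicit Types p q : 'I_n -> profile -> R.

Lemma allocation01 p i t : allocations p -> 0 <= p i t <= 1.
Proof.
move=> [_ /(_ i t)/andP[p0 pc] _]; rewrite p0 (le_trans pc)//.
by have /andP[] := cap01 i t.
Qed.

Lemma bounded_measurable_allocation p i : allocations p -> bounded_measurable (p i).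
Proof.
move=> Kp; apply: bounded_measurable01; first by have [] := Kp.
by move=> t; exact: allocation01.
Qed.
Let ba := bounded_measurable_allocation.

Lemma allocation_cvx p q a : 0 <= a <= 1 -> allocations p -> allocations q ->
  allocations (fun i t => (1 - a) * p i t + a * q i t).
Proof.
move=> /andP[a0 a1] [mp pc pH] [mq qc qH]; have a1' : 0 <= 1 - a by rewrite subr_ge0.
split=> [i|i t|t].
- by apply: measurable_funD; apply: measurable_funM => //; exact: measurable_cst.
- have /andP[p0 pc'] := pc i t; have /andP[q0 qc'] := qc i t.
  rewrite addr_ge0 ?mulr_ge0//=.
  rewrite (_ : cap i t = (1 - a) * cap i t + a * cap i t); last by ring.
  by rewrite lerD ?ler_wpM2l.
- rewrite big_split/= -!mulr_sumr.
  rewrite (_ : H t = (1 - a) * H t + a * H t); last by ring.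
  by rewrite lerD ?ler_wpM2l.
Qed.

Lemma allocation_mid p q : allocations p -> allocations q -> allocations (mid p q).
Proof.
have half01 : 0 <= (2^-1 : R) <= 1 by lra.
move=> Kp Kq; have := allocation_cvx half01 Kp Kq.
by rewrite (_ : 1 - 2^-1 = 2^-1 :> R)//; lra.
Qed.

Lemma interim01 p i x : allocations p -> 0 <= interim mu i (p i) x <= 1.
Proof.
move=> Kp; apply/andP; split.
  by apply: interim_ge0 => t; have /andP[] := allocation01 i t Kp.
by apply: interim_le1 => [|t]; [exact: ba|have /andP[] := allocation01 i t Kp].
Qed.

Lemma bounded_measurable_gap p i :
  allocations p -> bounded_measurable (fun x => interim mu i (p i) x - Q i x).
Proof.
move=> Kp; apply: bounded_measurableB; first exact/bounded_measurable_interim/ba.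
exact: bounded_measurable01.
Qed.
Let bg := bounded_measurable_gap.

(** The interim map is linear and squaring is convex. *)
Lemma interim_gap_mid p q : allocations p -> allocations q ->
  interim_gap (mid p q) <= (interim_gap p + interim_gap q) / 2.
Proof.
move=> Kp Kq; rewrite /interim_gap -big_split/= mulr_suml; apply: ler_sum => i _.
set u := fun x => interim mu i (p i) x - Q i x.
set v := fun x => interim mu i (q i) x - Q i x.
have bu2 : bounded_measurable (fun x => u x ^+ 2) by exact/bounded_measurable_sqr/bg.
have bv2 : bounded_measurable (fun x => v x ^+ 2) by exact/bounded_measurable_sqr/bg.
rewrite [leRHS](_ : _ =
    2^-1 * \int[mu i]_x (u x ^+ 2) + 2^-1 * \int[mu i]_x (v x ^+ 2)); last first.
  by rewrite /u /v; lra.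
rewrite -Rintegral_lin//; apply: le_Rintegral => //.
- apply: bounded_measurable_integrable; apply/bounded_measurable_sqr/bg.
  exact: allocation_mid.
- apply: bounded_measurable_integrable; apply: bounded_measurableD;
    by apply: bounded_measurableM => //; exact: bounded_measurable_cst.
move=> x _; rewrite interimD; last 2 first.
- by apply: bounded_measurableM; [exact: bounded_measurable_cst|exact: ba].
- by apply: bounded_measurableM; [exact: bounded_measurable_cst|exact: ba].
rewrite !interimZ; [|exact: ba|exact: ba].
rewrite /u /v; have := sqr_ge0 (interim mu i (p i) x - interim mu i (q i) x); nra.
Qed.

(** For [a], [b], [c] in the unit interval, [(a - c) ^+ 2 - (b - c) ^+ 2] is
    [(a - b) * (a + b - 2 * c)], whose second factor is at most 2 in absolute value. The interim
    difference is bounded by the interim value of [|p - q|]. Minimality can thus pass to L1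
    limits. *)
Lemma interim_gap_lip p q : allocations p -> allocations q ->
  interim_gap p <= interim_gap q + 2 * \sum_i \int[P]_t `|p i t - q i t|.
Proof.
move=> Kp Kq; rewrite /interim_gap mulr_sumr -big_split/=; apply: ler_sum => i _.
set u := fun x => interim mu i (p i) x - Q i x.
set v := fun x => interim mu i (q i) x - Q i x.
have bu2 : bounded_measurable (fun x => u x ^+ 2) by exact/bounded_measurable_sqr/bg.
have bv2 : bounded_measurable (fun x => v x ^+ 2) by exact/bounded_measurable_sqr/bg.
have bpq : bounded_measurable (fun t => p i t - q i t).
  by apply: bounded_measurableB; exact: ba.
have bw : bounded_measurable (interim mu i (fun t => `|p i t - q i t|)).
  exact/bounded_measurable_interim/bounded_measurable_norm.
rewrite (Rintegral_resample mu i); last exact: bounded_measurable_norm.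
rewrite -[X in _ <= X + _]mul1r -Rintegral_lin//; apply: le_Rintegral => //.
- exact: bounded_measurable_integrable.
- apply: bounded_measurable_integrable; apply: bounded_measurableD;
    by apply: bounded_measurableM => //; exact: bounded_measurable_cst.
move=> x _; have := le_norm_interim mu i x bpq.
rewrite interimB; [|exact: ba|exact: ba]; rewrite ler_norml => /andP[].
have := interim01 i x Kp; have := interim01 i x Kq; have := Q01 i x.
rewrite /u /v -/(interim mu i (fun t => `|p i t - q i t|) x).
move: (interim _ _ _ _) (interim _ _ (p i) _) (interim _ _ (q i) _) (Q i x).
move=> w a b c; nra.
Qed.

Lemma exists_interim_gap_minimizer :
  exists2 p, allocations p & forall q, allocations q -> interim_gap p <= interim_gap q.
Proof.
pose N (p : 'I_n -> profile -> R) := \sum_i \int[P]_t (p i t ^+ 2).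
pose dist2 (p q : 'I_n -> profile -> R) := \sum_i \int[P]_t ((p i t - q i t) ^+ 2).
have [m hm] : exists m : R -> 'I_n -> profile -> R, forall e, 0 < e ->
    [/\ allocations (m e),
        forall q, allocations q -> interim_gap (m e) <= interim_gap q + e &
        forall e', 0 < e' -> dist2 (m e) (m e') <= 8 * Num.max e e'].
  apply: (@uniform_approx_minimizers _ _ _ mid _ N dist2 n%:R).
  - exists (fun _ _ => 0); split=> [i|i t|t]; first exact: measurable_cst.
      by rewrite lexx /=; have /andP[] := cap01 i t.
    by rewrite big1.
  - exact: allocation_mid.
  - by move=> p _; apply: sumr_ge0 => i _; apply: Rintegral_ge0 => x _; exact: sqr_ge0.
  - move=> p Kp; apply/andP; split.
      by apply: sumr_ge0 => i _; apply: Rintegral_ge0 => x _; exact: sqr_ge0.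
    rewrite -[leRHS](_ : \sum_(i < n) \int[P]_t 1 = n%:R); last first.
      under eq_bigr do rewrite Rintegral_prob_cst.
      by rewrite sumr_const card_ord.
    apply: ler_sum => i _; apply: le_Rintegral => //.
    + exact/bounded_measurable_integrable/bounded_measurable_sqr/ba.
    + exact/bounded_measurable_integrable/bounded_measurable_cst.
    + by move=> t _; have := allocation01 i t Kp => /andP[p0 p1]; rewrite expr_le1.
  - exact: interim_gap_mid.
  - move=> p q Kp Kq; rewrite /N /dist2 -big_split/= !mulr_suml -sumrB.
    apply: eq_bigr => i _.
    have bp2 := bounded_measurable_sqr (ba i Kp).
    have bq2 := bounded_measurable_sqr (ba i Kq).
    have bpq2 := bounded_measurable_sqr (bounded_measurableB (ba i Kp) (ba i Kq)).
    have bpq : bounded_measurable (fun t => 1 * p i t ^+ 2 + 1 * q i t ^+ 2).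
      by apply: bounded_measurableD;
        apply: bounded_measurableM => //; exact: bounded_measurable_cst.
    (* The parallelogram identity, pointwise before integration. *)
    transitivity (\int[P]_t (2^-1 * (1 * p i t ^+ 2 + 1 * q i t ^+ 2) +
        (- 4^-1) * (p i t - q i t) ^+ 2)).
      by apply: eq_Rintegral => t _; rewrite /mid; field.
    by rewrite Rintegral_lin// Rintegral_lin//; field.
(* [c k] is the intended L1 size of the [k]-th increment, chosen summable. The tolerance [e k] is
   [c k ^+ 2 / 8] so that the factor 8 cancels and the squared L2 increment is at most
   [c k ^+ 2]. *)
pose c k : R := 1 / (2 ^ k.+1)%:R.
have c0 k : 0 < c k by rewrite divr_gt0// ltr0n expn_gt0.
have cS k : c k.+1 <= c k.
  by rewrite /c !div1r lef_pV2 ?posrE ?ltr0n ?expn_gt0// ler_nat leq_exp2l.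
pose e k : R := c k ^+ 2 / 8.
have e0 k : 0 < e k by rewrite divr_gt0// exprn_gt0.
have eS k : e k.+1 <= e k.
  by rewrite ler_pM2r ?invr_gt0// ler_pXn2r ?nnegrE// ltW.
pose p k := m (e k).
have Kp k : allocations (p k) by have [] := hm _ (e0 k).
have bdp k l i : bounded_measurable (fun t => p k i t - p l i t).
  by apply: bounded_measurableB; exact: ba.
have pdist2 k i : \int[P]_t ((p k.+1 i t - p k i t) ^+ 2) <= c k ^+ 2.
  have [_ _ /(_ _ (e0 k))] := hm _ (e0 k.+1).
  rewrite max_r// /e mulrCA divff// mulr1 => dc; apply: le_trans dc.
  rewrite /dist2 (bigD1 i)//= lerDl; apply: sumr_ge0 => j _.
  by apply: Rintegral_ge0 => t _; exact: sqr_ge0.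
have pdist k i : \int[P]_t `|p k.+1 i t - p k i t| <= c k.
  have c2 : (2 * c k)^-1 * c k ^+ 2 = c k / 2.
    by have := lt0r_neq0 (c0 k) => ?; field.
  have : \int[P]_t `|p k.+1 i t - p k i t| <=
      \int[P]_t ((c k / 2) * 1 + (2 * c k)^-1 * (p k.+1 i t - p k i t) ^+ 2).
    apply: le_Rintegral => //.
    - exact/bounded_measurable_integrable/bounded_measurable_norm.
    - apply: bounded_measurable_integrable; apply: bounded_measurableD.
        exact: bounded_measurable_cst.
      by apply: bounded_measurableM;
        [exact: bounded_measurable_cst|exact: bounded_measurable_sqr].
    (* AM-GM: [2 c |x| <= c^2 + x^2] *)
    move=> t _; set x := p k.+1 i t - _.
    rewrite -(@ler_pM2l _ (2 * c k)) ?mulr_gt0//.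
    have -> : 2 * c k * (c k / 2 * 1 + (2 * c k)^-1 * x ^+ 2) = c k ^+ 2 + x ^+ 2.
      by have := lt0r_neq0 (c0 k) => ?; field.
    by have := sqr_ge0 (`|x| - c k); rewrite sqrrB real_normK ?num_real//; lra.
  move=> /le_trans; apply.
  rewrite Rintegral_lin//;
    [|exact: bounded_measurable_cst|exact: bounded_measurable_sqr].
  rewrite Rintegral_prob_cst mulr1.
  have : (2 * c k)^-1 * \int[P]_t ((p k.+1 i t - p k i t) ^+ 2) <= c k / 2.
    by rewrite -c2 ler_pM2l// invr_gt0 mulr_gt0.
  lra.
have [p' [mp' limp' L1p']] : exists p' : 'I_n -> profile -> R,
    [/\ forall i, measurable_fun setT (p' i),
        forall t, (forall i, p ^~ i ^~ t @ \oo --> p' i t) \/ (forall i, p' i t = 0) &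
        forall i, \int[P]_t `|p k i t - p' i t| @[k --> \oo] --> 0].
  apply: L1_limit => [k i|k i t|i]; first by have [] := Kp k.
    exact: allocation01.
  apply: (@le_lt_trans _ _ (\sum_(k <oo) (1 / (2 ^ k.+1)%:R)%:E)%E).
    apply: lee_nneseries => [k _ _|k _]; first by apply: integral_ge0 => t _.
    by rewrite integral_bounded_measurable ?lee_fin//; exact: bounded_measurable_norm.
  exact: le_lt_trans (epsilon_trick0 _ ler01) (ltry _).
have Kp' : allocations p'.
  split=> // [i t|t].
    have [/(_ i) cp|->] := limp' t; last by rewrite lexx; have /andP[] := cap01 i t.
    rewrite -(cvg_lim _ cp)//; apply/andP; split.
      apply: limr_ge; first by apply: cvgP cp.
      by apply: nearW => k; have [_ /(_ i t)/andP[]] := Kp k.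
    apply: limr_le; first by apply: cvgP cp.
    by apply: nearW => k; have [_ /(_ i t)/andP[]] := Kp k.
  have [cp|p'0] := limp' t; last by rewrite big1.
  have cs : \sum_i p k i t @[k --> \oo] --> \sum_i p' i t.
    by apply: cvg_sum_ord => i; exact: cp.
  rewrite -(cvg_lim _ cs)//; apply: limr_le; first by apply: cvgP cs.
  by apply: nearW => k; have [] := Kp k.
exists p' => // q Kq.
(* A crude harmonic bound, enough to show that the tolerances tend to 0. *)
have e_harm k : e k <= k.+1%:R^-1.
  have ck : c k <= k.+1%:R^-1.
    by rewrite /c div1r lef_pV2 ?posrE ?ltr0n ?expn_gt0// ler_nat ltnW// ltn_expl.
  have ck1 : c k <= 1 by rewrite (le_trans ck)// invf_le1 ?ler1n ?ltr0n.
  apply: le_trans ck; rewrite ler_pdivrMr// expr2 ler_wpM2l ?(ltW (c0 k))//; lra.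
(* The sequence bounds [interim_gap p'] from above: the tolerance of [p k] plus the Lipschitz cost
   of replacing [p k] by [p']. Its limit is [interim_gap q]. *)
have cL1 : interim_gap q + (k.+1%:R^-1 + 2 * \sum_i \int[P]_t `|p k i t - p' i t|)
    @[k --> \oo] --> interim_gap q + (0 + 2 * \sum_(i < n) 0).
  apply: cvgD; first exact: cvg_cst.
  apply: cvgD; first exact: cvg_harmonic.
  apply: cvgM; first exact: cvg_cst.
  by apply: cvg_sum_ord.
rewrite sumr_const mul0rn mulr0 !addr0 in cL1.
rewrite -(cvg_lim _ cL1)//; apply: limr_ge; first by apply: cvgP cL1.
apply: nearW => k; apply: le_trans (interim_gap_lip Kp' (Kp k)) _.
rewrite addrA lerD//.
  have [_ /(_ _ Kq) gq _] := hm _ (e0 k).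
  by apply: le_trans gq _; rewrite lerD2l.
rewrite ler_pM2l//; apply: ler_sum => i _; apply: le_Rintegral => //.
- apply/bounded_measurable_integrable/bounded_measurable_norm.
  by apply: bounded_measurableB; exact: ba.
- apply/bounded_measurable_integrable/bounded_measurable_norm.
  by apply: bounded_measurableB; exact: ba.
- by move=> t _; rewrite distrC.
Qed.

End minimizer.

(** * First-order optimality and domination of the target *)

Section domination.
Context d (T : measurableType d) (R : realType) (n : nat).
Variable mu : 'I_n -> probability T R.
Local Notation profile := (n.-tuple T).
Local Notation P := (product_law mu).
Variables (cap : 'I_n -> profile -> R) (H : profile -> R).
Hypothesis cap01 : forall i t, 0 <= cap i t <= 1.
Hypothesis H0 : forall t, 0 <= H t.
Variable Q : 'I_n -> T -> R.
Hypothesis mQ : forall i, measurable_fun setT (Q i).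
Hypothesis Q01 : forall i x, 0 <= Q i x <= 1.
Local Notation allocations := (allocations cap H).
Local Notation interim_gap := (interim_gap mu Q).
Let ba := bounded_measurable_allocation cap01 (H:=H).
Let bg := bounded_measurable_gap mu cap01 mQ Q01 (H:=H).
Implicit Types p q : 'I_n -> profile -> R.
(** Along the segment from [p] to [q] the gap is a quadratic polynomial in the step, with linear
    coefficient twice the sum in question. A minimum at step 0 rules out a negative slope. *)
Lemma interim_gap_variation p q : allocations p ->
  (forall r, allocations r -> interim_gap p <= interim_gap r) -> allocations q ->
  0 <= \sum_i \int[P]_t
    ((interim mu i (p i) (tnth t i) - Q i (tnth t i)) * (q i t - p i t)).
Proof.
move=> Kp pmin Kq.
have bqp i : bounded_measurable (fun t => q i t - p i t).
  by apply: bounded_measurableB; exact: ba.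
have bI i : bounded_measurable (interim mu i (fun t => q i t - p i t)).
  exact/bounded_measurable_interim.
under eq_bigr => i _ do rewrite (Rintegral_interim _ i (bg i Kp) (bqp i)).
set L := \sum_i _.
pose B := \sum_i \int[mu i]_x (interim mu i (fun t => q i t - p i t) x ^+ 2).
have B0 : 0 <= B.
  by apply: sumr_ge0 => i _; apply: Rintegral_ge0 => x _; exact: sqr_ge0.
have gapE a : interim_gap (fun i t => (1 - a) * p i t + a * q i t) =
    interim_gap p + (2 * a * L + a ^+ 2 * B).
  rewrite /L /B !mulr_sumr -!big_split/=; apply: eq_bigr => i _.
  set u := fun x => interim mu i (p i) x - Q i x.
  set v := interim mu i (fun t => q i t - p i t).
  have bu2 : bounded_measurable (fun x => u x ^+ 2) by exact/bounded_measurable_sqr/bg.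
  have bv2 : bounded_measurable (fun x => v x ^+ 2) by exact/bounded_measurable_sqr/bI.
  have buv : bounded_measurable (fun x => u x * v x).
    by apply: bounded_measurableM; [exact: bg|exact: bI].
  have buv2 : bounded_measurable (fun x => 2 * a * (u x * v x) + a ^+ 2 * v x ^+ 2).
    by apply: bounded_measurableD;
      apply: bounded_measurableM => //; exact: bounded_measurable_cst.
  transitivity (\int[mu i]_x (1 * u x ^+ 2 +
      1 * (2 * a * (u x * v x) + a ^+ 2 * v x ^+ 2))); last first.
    by rewrite Rintegral_lin// Rintegral_lin// !mul1r.
  apply: eq_Rintegral => x _; rewrite /u /v.
  have bc b (w : profile -> R) :
      bounded_measurable w -> bounded_measurable (fun t => b * w t).
    by apply: bounded_measurableM; exact: bounded_measurable_cst.
  rewrite interimB; [|exact: ba..].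
  have -> : interim mu i (fun t => (1 - a) * p i t + a * q i t) x =
      (1 - a) * interim mu i (p i) x + a * interim mu i (q i) x.
    by rewrite interimD ?interimZ; [|exact: ba|exact: ba|exact/bc/ba|exact/bc/ba].
  ring.
rewrite leNgt; apply/negP => L0.
(* Moving from p towards q by a changes the gap by [a * (2 * L + a * B)]. *)
pose a := - L / (B + 1 - L).
(* The step lies in the unit interval and satisfies [a * B <= - L], so the change is at most
   [a * L], which is negative. *)
have D0 : 0 < B + 1 - L by lra.
have a0 : 0 < a by rewrite divr_gt0// oppr_gt0.
have a1 : a <= 1 by rewrite ler_pdivrMr//; lra.
have aB : a * B <= - L.
  by rewrite mulrAC ler_pdivrMr// ler_wpM2l//; lra.
have a01 : 0 <= a <= 1 by rewrite ltW.
have := pmin _ (allocation_cvx a01 Kp Kq).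
rewrite gapE lerDl (_ : _ + _ = a * (2 * L + a * B)); last by ring.
by rewrite pmulr_rge0// leNgt => /negP; apply; lra.
Qed.

Lemma allocation_interim_dominates : measurable_fun setT H ->
  (forall i, measurable_fun setT (cap i)) ->
  (forall E : 'I_n -> set T, (forall i, measurable (E i)) ->
    \sum_i \int[mu i]_x (\1_(E i) x * Q i x) <=
    \int[P]_t Num.min (\sum_i \1_(E i) (tnth t i) * cap i t) (H t)) ->
  exists2 p, allocations p &
    forall i, {ae mu i, forall x, Q i x <= interim mu i (p i) x}.
Proof.
move=> mH mcap hall.
have [p Kp pmin] := exists_interim_gap_minimizer mu cap01 H0 mQ Q01.
exists p => //.
pose c i x := Q i x - interim mu i (p i) x.
have bc i : bounded_measurable (c i).
  apply: bounded_measurableB; first exact: bounded_measurable01.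
  exact/bounded_measurable_interim/ba.
pose E i := [set x | 0 < c i x].
have mE i : measurable (E i).
  have := measurable_fun_ltr (measurable_cst (0 : R)) (bc i).1.
  by move=> /(_ measurableT [set true]); rewrite setTI; exact.
pose e i t : R := \1_(E i) (tnth t i).
have be i : bounded_measurable (e i).
  exact: bounded_measurable_tnth (bounded_measurable_indic _ (mE i)).
have e01 i t : e i t = 0 /\ c i (tnth t i) <= 0 \/ e i t = 1 /\ 0 < c i (tnth t i).
  rewrite /e indicE; have [tE|tE] := boolP (tnth t i \in E i).
    by right; split=> //; move: tE; rewrite inE.
  by left; split=> //; rewrite leNgt; move: tE; rewrite notin_setE => /negP.
have pcap i t : 0 <= p i t <= cap i t by have [_] := Kp.
have bcap i : bounded_measurable (cap i) by exact: bounded_measurable01.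
(* For the agents with positive gap: [S] is what they receive under [p], [C] their total capacity,
   and [M] the most they could receive. *)
pose S t := \sum_i e i t * p i t.
pose C t := \sum_i e i t * cap i t.
pose M t := Num.min (C t) (H t).
have bS : bounded_measurable S.
  by apply: bounded_measurable_sum => i; apply: bounded_measurableM => //; exact: ba.
have bC : bounded_measurable C.
  by apply: bounded_measurable_sum => i; exact: bounded_measurableM.
have SC t : S t <= C t.
  apply: ler_sum => i _; have /andP[_ pc] := pcap i t.
  by have [[-> _]|[-> _]] := e01 i t; rewrite ?mul0r ?mul1r.
have SM t : S t <= M t.
  rewrite le_min SC /=; have [_ _ /(_ t)] := Kp; apply: le_trans.
  apply: ler_sum => i _; have /andP[p0 _] := pcap i t.
  by have [[-> _]|[-> _]] := e01 i t; rewrite ?mul0r ?mul1r.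
have Cn t : C t <= n.+1%:R.
  rewrite (@le_trans _ _ n%:R) ?ler_nat// -[leRHS](_ : \sum_(i < n) 1 = n%:R).
    apply: ler_sum => i _; have /andP[c0 c1] := cap01 i t.
    by have [[-> _]|[-> _]] := e01 i t; rewrite ?mul0r ?mul1r.
  by rewrite sumr_const card_ord.
have S0 t : 0 <= S t.
  apply: sumr_ge0 => i _; have /andP[p0 _] := pcap i t.
  by have [[-> _]|[-> _]] := e01 i t; rewrite ?mul0r ?mul1r.
have MC t : M t <= C t by rewrite ge_min lexx.
have bM : bounded_measurable M.
  split; first exact: measurable_minr bC.1 mH.
  exists n.+1%:R => t; rewrite ger0_norm; first exact: le_trans (MC t) (Cn t).
  exact: le_trans (S0 t) (SM t).
(* [w] is positive exactly where [S] falls short of [M]. The factor keeps it at most 1 and, since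
   [C - S] is at most [n + 1], gives [w * (C - S) <= M - S]; using [n + 1] avoids dividing by zero
   when there are no agents. *)
pose w t := n.+1%:R^-1 * (M t - S t).
have bw : bounded_measurable w.
  by apply: bounded_measurableM;
    [exact: bounded_measurable_cst|exact: bounded_measurableB].
have w0 t : 0 <= w t by rewrite mulr_ge0// subr_ge0.
have w1 t : w t <= 1.
  rewrite /w mulrC ler_pdivrMr ?ltr0n// mul1r.
  by have := Cn t; have := MC t; have := S0 t; lra.
have wCS t : w t * (C t - S t) <= M t - S t.
  rewrite /w mulrAC ler_piMl ?subr_ge0//.
  rewrite mulrC ler_pdivrMr ?ltr0n// mul1r.
  by have := Cn t; have := S0 t; lra.
pose q i t := e i t * (p i t + w t * (cap i t - p i t)).
have Kq : allocations q.
  split=> [i|i t|t].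
  - suff [] : bounded_measurable (q i) by [].
    apply: bounded_measurableM => //; apply: bounded_measurableD; first exact: ba.
    apply: bounded_measurableM => //; apply: bounded_measurableB => //; exact: ba.
  - rewrite /q; have /andP[p0 pc] := pcap i t; have /andP[c0 _] := cap01 i t.
    have := w0 t; have := w1 t.
    have [[-> _]|[-> _]] := e01 i t; rewrite ?mul0r ?mul1r ?lexx//; nra.
  - rewrite (_ : \sum_i _ = S t + w t * (C t - S t)); last first.
      rewrite /S /C -sumrB mulr_sumr -big_split/=; apply: eq_bigr => i _.
      by rewrite /q; ring.
    have : M t <= H t by rewrite ge_min lexx orbT.
    by have := wCS t; lra.
have := interim_gap_variation Kp pmin Kq.
have bcqp i : bounded_measurable (fun t => c i (tnth t i) * (q i t - p i t)).
  apply: bounded_measurableM; first exact: bounded_measurable_tnth.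
  by apply: bounded_measurableB; exact: ba.
(* Every term of the variation has the same sign: shares fall where the gap is nonpositive and rise
   where it is positive. Optimality bounds the sum of the integrals the other way, so each term
   vanishes almost everywhere. *)
have cqp0 i t : 0 <= c i (tnth t i) * (q i t - p i t).
  have /andP[p0 pc] := pcap i t.
  rewrite /q; have [[-> c0]|[-> c0]] := e01 i t.
    by rewrite mul0r sub0r mulrN -mulNr mulr_ge0// oppr_ge0.
  by rewrite mul1r addrAC subrr add0r mulr_ge0 ?(ltW c0)// mulr_ge0 ?subr_ge0.
move=> vari.
have SMae : {ae P, forall t, S t = M t}.
  have : {ae P, forall t, forall i, c i (tnth t i) * (q i t - p i t) = 0}.
    apply: ae_forall_ord => i; apply: Rintegral_le0_ae_eq0 => //.
    have int0 j : 0 <= \int[P]_t (c j (tnth t j) * (q j t - p j t)).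
      by apply: Rintegral_ge0.
    have : \sum_j \int[P]_t (c j (tnth t j) * (q j t - p j t)) <= 0.
      rewrite -oppr_ge0 -sumrN; apply: le_trans vari _; apply: ler_sum => j _.
      rewrite -mulN1r -RintegralZl//; last exact: bounded_measurable_integrable.
      by rewrite le_eqVlt; apply/orP; left; apply/eqP/eq_Rintegral => t _;
        rewrite /c; ring.
    apply: le_trans; rewrite (bigD1 i)//= lerDl; apply: sumr_ge0 => j _.
    exact: int0.
  apply: filterS => t cqp.
  (* Inside [E] the gap is positive, so the vanishing products leave [w * (cap - p) = 0]. After
     summation, either [w] is 0 and [S = M], or [S = C] and [M] cannot exceed it. *)
  have wCS0 : w t * (C t - S t) = 0.
    rewrite /S /C -sumrB mulr_sumr big1// => i _.
    move: (cqp i); rewrite /q; have [[-> _]|[-> ci]] := e01 i t.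
      by rewrite !mul0r subrr mulr0.
    rewrite !mul1r addrAC subrr add0r => /eqP; rewrite mulf_eq0 gt_eqF//=.
    by move=> /eqP.
  apply/eqP; rewrite eq_le SM /=; move/eqP: wCS0; rewrite mulf_eq0 => /orP[|].
    by rewrite /w mulf_eq0 invr_eq0 pnatr_eq0/= subr_eq0 => /eqP ->.
  by rewrite subr_eq0 => /eqP <-; exact: MC.
have bcE i : bounded_measurable (fun x => \1_(E i) x * c i x).
  by apply: bounded_measurableM => //; exact: bounded_measurable_indic.
have cE0 i x : 0 <= \1_(E i) x * c i x.
  rewrite indicE; have [xE|xE] := boolP (x \in E i); last by rewrite mul0r.
  by rewrite mul1r ltW//; move: xE; rewrite inE.
(* The sum equals the left side of the inequality for [E] minus the integral of [S], and [S] may be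
   replaced by [M] under the integral. *)
have sum_cE : \sum_i \int[mu i]_x (\1_(E i) x * c i x) <= 0.
  have bEQ i : bounded_measurable (fun x => \1_(E i) x * Q i x).
    by apply: bounded_measurableM;
      [exact: bounded_measurable_indic|exact: bounded_measurable01].
  have bEI i : bounded_measurable (fun x => \1_(E i) x * interim mu i (p i) x).
    by apply: bounded_measurableM;
      [exact: bounded_measurable_indic|exact/bounded_measurable_interim/ba].
  have -> : \sum_i \int[mu i]_x (\1_(E i) x * c i x) =
      \sum_i \int[mu i]_x (\1_(E i) x * Q i x) - \int[P]_t S t.
    rewrite Rintegral_sum; last first.
      by move=> i; apply: bounded_measurableM => //; exact: ba.
    rewrite -sumrB; apply: eq_bigr => i _.
    rewrite Rintegral_interim; [|exact: bounded_measurable_indic|exact: ba].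
    rewrite -RintegralB//; [|exact: bounded_measurable_integrable..].
    by apply: eq_Rintegral => x _; rewrite /c mulrBr.
  rewrite subr_le0 (ae_eq_Rintegral bS bM SMae); exact: hall.
move=> i.
have /(Rintegral_le0_ae_eq0 (bcE i) (cE0 i)) : \int[mu i]_x (\1_(E i) x * c i x) <= 0.
  apply: le_trans sum_cE; rewrite (bigD1 i)//= lerDl; apply: sumr_ge0 => j _.
  exact: Rintegral_ge0.
apply: filterS => x; rewrite indicE; have [xE|xE] := boolP (x \in E i).
  by rewrite mul1r => c0; move: xE; rewrite inE /E /= c0 ltxx.
by move: xE; rewrite notin_setE /E /= => /negP; rewrite -leNgt subr_le0.
Qed.

End domination.

(** * Type laws on the unit interval, and integrals over sets of full measure *)

(** The Stieltjes measure is given by increments of [F] on left-open intervals. Those from slightly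
    below 0 to 1 all have mass 1 and decrease to the closed interval, which keeps a possible atom at
    0. *)
Lemma type_law_type_space (R : realType) (F : cumulativeBounded (0 : R) (1 : R)) :
  type_cdf F -> type_law F (type_space R) = 1%E.
Proof.
move=> [F0 F1].
pose U k : set (measurableTypeR R) := `](- k.+1%:R^-1), 1]%classic.
have type_spaceE : type_space R = \bigcap_k U k.
  apply/seteqP; split=> x; rewrite /type_space /= in_itv/=.
    move=> /andP[x0 x1] k _; rewrite /U /= in_itv/= x1 andbT.
    by rewrite (lt_le_trans _ x0)// oppr_lt0 invr_gt0.
  move=> Ux; have := Ux 0%N I; rewrite /U /= in_itv/= => /andP[_ ->]; rewrite andbT.
  rewrite leNgt; apply/negP => x0.
  have [k kx] := ltr_add_invr x0.
  have := Ux k I; rewrite /U /= in_itv/= => /andP[+ _].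
  by move: kx; rewrite -ltrBrDr sub0r => /lt_trans /[apply]; rewrite ltxx.
have mU k : measurable (U k) by exact: measurable_itv.
have U1 k : type_law F (U k) = 1%E.
  rewrite /type_law /= /lebesgue_stieltjes_measure /measure_extension.
  rewrite measurable_mu_extE/=; last exact: is_ocitv.
  have k0 : - k.+1%:R^-1 < 0 :> R by rewrite oppr_lt0 invr_gt0.
  by rewrite wlength_itv_bnd ?F1 ?(F0 _ k0) ?subr0// (le_trans (ltW k0)).
have cvgU : type_law F \o U @ \oo --> type_law F (\bigcap_k U k).
  apply: nonincreasing_cvg_mu => //.
  - by rewrite (le_lt_trans (probability_le1 (type_law F) (mU 0%N))) ?ltry.
  - exact: bigcap_measurable.
  - move=> k l kl; apply/subsetPset/subset_itvr; rewrite bnd_simp lerN2.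
    by rewrite lef_pV2 ?posrE// ler_nat ltnS.
rewrite type_spaceE; apply: (cvg_unique _ cvgU) => //.
rewrite (_ : _ \o _ = cst 1%E); first exact: cvg_cst.
by apply/funext => k; exact: U1.
Qed.

(** On nonnegative reals the inverse, including its value 0 at 0, is the power with exponent -1, a
    measurable function. *)
Lemma measurable_ratio_max d (T : measurableType d) (R : realType) (u v : T -> R) :
  measurable_fun setT u -> measurable_fun setT v -> (forall x, 0 <= u x) ->
  measurable_fun setT (fun x => u x / Num.max (u x) (v x)).
Proof.
move=> mu mv u0; under eq_fun do rewrite -powR_inv1 ?le_max ?u0//.
apply: measurable_funM => //.
exact: (measurableT_comp (measurable_powR (-1)) (measurable_maxr mu mv)).
Qed.

Lemma integral_full_set d (X : measurableType d) (R : realType) (P : probability X R)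
    (D : set X) (u : X -> R) : measurable D -> P D = 1%E -> bounded_measurable u ->
  (\int[P]_(x in D) (u x)%:E = (\int[P]_x u x)%:E)%E.
Proof.
move=> mD PD bu; rewrite -integral_bounded_measurable// [LHS]integral_mkcond.
have mu : measurable_fun setT (EFin \o u) by apply/measurable_EFinP; exact: bu.1.
apply: ae_eq_integral => //.
  by apply/(measurable_restrictT _ mD); exact: measurable_funTS.
exists (~` D); split; first exact: measurableC.
  by apply: etrans (probability_setC P mD) _; rewrite PD subee.
by move=> x; apply: contra_notP => /= /contrapT Dx _; rewrite patchE mem_set.
Qed.

(** * Capacities, supply and the demand integral *)

Section auction.
Context (R : realType) (n : nat).
Local Notation profile := (n.-tuple (measurableTypeR R)).
Variables (F : 'I_n -> cumulativeBounded (0 : R) (1 : R)).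
Variables (h : profile -> nat) (J : profile -> {set 'I_n}).
Hypothesis hF : forall i, type_cdf (F i).
Hypothesis mh : measurable_fun (profile_space R n) h.
Hypothesis mJ : forall i, measurable_fun (profile_space R n) (fun t => i \in J t).
Local Notation D := (profile_space R n).

Lemma measurable_type_space : measurable (type_space R).
Proof. exact: measurable_itv. Qed.

Lemma measurable_profile_space : measurable D.
Proof. by apply: measurable_box => _; exact: measurable_type_space. Qed.

Lemma joint_law_profile_space : joint_law F D = 1%E.
Proof.
rewrite /joint_law [LHS]product_law_box; last by move=> _; exact: measurable_type_space.
by apply: big1 => i _; exact: type_law_type_space.
Qed.

(** Extension by 0 makes the function measurable on all tuples and leaves no capacity outside the
    profile space. *)
Definition capacity i : profile -> R := (fun t => (i \in J t)%:R : R) \_ D.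

Definition supply : profile -> R := (fun t => (h t)%:R : R) \_ D.

Lemma measurable_capacity i : measurable_fun setT (capacity i).
Proof.
apply/(measurable_restrictT _ measurable_profile_space).
exact: (measurableT_comp (f := fun b : bool => (b%:R : R))).
Qed.

Lemma measurable_supply : measurable_fun setT supply.
Proof.
apply/(measurable_restrictT _ measurable_profile_space).
exact: (measurableT_comp (f := fun k : nat => (k%:R : R))).
Qed.

Lemma capacity01 i t : 0 <= capacity i t <= 1.
Proof.
by rewrite /capacity patchE; case: ifP; case: (_ \in J t); rewrite /= ?lexx ?ler01.
Qed.

Lemma supply_ge0 t : 0 <= supply t.
Proof. by rewrite /supply patchE; case: ifP. Qed.

(** The supply may be unbounded; the minimum inherits its bound from the finite sum of
    capacities. *)
Lemma bounded_measurable_demand (E : 'I_n -> set (measurableTypeR R)) :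
  (forall i, measurable (E i)) -> bounded_measurable
    (fun t => Num.min (\sum_i \1_(E i) (tnth t i) * capacity i t) (supply t)).
Proof.
move=> mE.
have [mS [M SM]] : bounded_measurable
    (fun t : profile => \sum_i \1_(E i) (tnth t i) * capacity i t).
  apply: bounded_measurable_sum => i; apply: bounded_measurableM.
    by apply: bounded_measurable_tnth; exact: bounded_measurable_indic.
  apply: bounded_measurable01; first exact: measurable_capacity.
  by move=> t; exact: capacity01.
split; first exact: measurable_minr mS measurable_supply.
exists M => t; rewrite ger0_norm ?le_min ?supply_ge0 ?andbT.
  by rewrite (le_trans _ (SM t))// (le_trans _ (ler_norm _))// ge_min lexx.
apply: sumr_ge0 => i _; rewrite mulr_ge0// ?indicE//.
by have /andP[] := capacity01 i t.
Qed.

(** The cardinality is a sum of products of indicators, and outside the profile space the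
    real-valued minimum is 0. *)
Lemma integral_demand (E : 'I_n -> set (measurableTypeR R)) :
  (forall i, measurable (E i)) ->
  (\int[joint_law F]_(t in D) (minn #|(J t :&: agents_in E t)%SET| (h t))%:R%:E =
   (\int[joint_law F]_t
      Num.min (\sum_i \1_(E i) (tnth t i) * capacity i t) (supply t))%:E)%E.
Proof.
move=> mE; rewrite -integral_bounded_measurable; last exact: bounded_measurable_demand.
rewrite integral_mkcond; apply: eq_integral => t _; rewrite patchE.
rewrite /capacity /supply; under eq_bigr do rewrite patchE.
rewrite patchE; case: ifPn => tD; last first.
  by rewrite big1 ?minxx// => i _; rewrite mulr0.
rewrite -minEnat natr_min; congr (Num.min _ _)%:E.
rewrite -sum1_card natr_sum big_mkcond/=; apply: eq_bigr => i _.
rewrite inE inE indicE andbC.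
by case: (_ \in E i); case: (_ \in J t); rewrite /= ?mulr0 ?mul0r ?mulr1.
Qed.

Lemma integral_interim_rule (P : 'I_n -> measurableTypeR R -> R) i
    (E : set (measurableTypeR R)) : interim_rule P ->
  measurable E ->
  (\int[type_law (F i)]_(x in E `&` type_space R) (P i x)%:E =
   (\int[type_law (F i)]_x (\1_E x * (P i \_ (type_space R)) x))%:E)%E.
Proof.
move=> hP mE; have [mPi Pi01] := hP i.
rewrite -integral_bounded_measurable; last first.
  apply: bounded_measurableM; first exact: bounded_measurable_indic.
  apply: bounded_measurable01.
    exact/(measurable_restrictT _ measurable_type_space).
  move=> x; rewrite patchE; case: ifPn => [|_]; last by rewrite lexx ler01.
  by rewrite inE => /Pi01.
rewrite integral_mkcond; apply: eq_integral => x _; rewrite !patchE in_setI indicE.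
by case: (_ \in E); case: (_ \in type_space R); rewrite /= ?mulr0 ?mul0r ?mul1r.
Qed.

End auction.

(** * Necessity and sufficiency of the inequalities *)

Theorem lemma5 (R : realType) (n : nat)
    (F : 'I_n -> cumulativeBounded (0 : R) (1 : R))
    (h : n.-tuple (measurableTypeR R) -> nat)
    (J : n.-tuple (measurableTypeR R) -> {set 'I_n})
    (P : 'I_n -> measurableTypeR R -> R)
    (hF : forall i, type_cdf (F i))
    (mh : measurable_fun (profile_space R n) h)
    (mJ : forall i, measurable_fun (profile_space R n) (fun t => i \in J t))
    (hP : interim_rule P) :
  (exists p : 'I_n -> n.-tuple (measurableTypeR R) -> R,
     [/\ allocation_rule p, feasible h J p & induces F p P]) <->
  (forall E : 'I_n -> set (measurableTypeR R),
     (forall i, measurable (E i) /\ E i `<=` type_space R) ->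
     (\sum_(i < n) \int[type_law (F i)]_(x in E i) (P i x)%:E <=
      \int[joint_law F]_(t in profile_space R n)
        (minn #|(J t :&: agents_in E t)%SET| (h t))%:R%:E)%E).
Proof.
pose mu i := type_law (F i).
have mTS := @measurable_type_space R.
have mD := @measurable_profile_space R n.
pose Q i := P i \_ (type_space R).
have mQ i : measurable_fun setT (Q i).
  by apply/(measurable_restrictT _ mTS); exact: (hP i).1.
have Q01 i x : 0 <= Q i x <= 1.
  rewrite /Q patchE; case: ifPn => [|_]; last by rewrite lexx ler01.
  by rewrite inE => /(hP i).2.
have bQ i : bounded_measurable (Q i) by exact: bounded_measurable01.
have bE (E : set (measurableTypeR R)) (u : measurableTypeR R -> R) :
    measurable E -> bounded_measurable u ->
    bounded_measurable (fun x => \1_E x * u x).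
  by move=> mE; apply: bounded_measurableM; exact: bounded_measurable_indic.
have capacity_mk i t : profile_space R n t -> capacity J i t = (i \in J t)%:R.
  by move=> Dt; rewrite /capacity patchE mem_set.
have supply_mk t : profile_space R n t -> supply h t = (h t)%:R.
  by move=> Dt; rewrite /supply patchE mem_set.
split=> [[p [pA pF pI]] E hE|hall].
- have EE i : E i = E i `&` type_space R by rewrite setIidl//; exact: (hE i).2.
  have mE i : measurable (E i) := (hE i).1.
  rewrite (integral_demand F mh mJ mE).
  under eq_bigr => i _ do rewrite EE (integral_interim_rule F i hP (mE i)).
  rewrite sumEFin lee_fin.
  pose u i := p i \_ (profile_space R n).
  have uD i t : profile_space R n t -> u i t = p i t.
    by move=> Dt; rewrite /u patchE mem_set.
  have uND i t : ~ profile_space R n t -> u i t = 0.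
    by move=> Dt; rewrite /u patchE memNset.
  have bu i : bounded_measurable (u i).
    apply: bounded_measurable01.
      by apply/(measurable_restrictT _ mD); exact: (pA i).1.
    move=> t; have [Dt|Dt] := pselect (profile_space R n t).
      by rewrite uD//; exact: (pA i).2.
    by rewrite uND// lexx ler01.
  (* Equality of [P i] with the interim expectation for almost every type suffices under the
     integral. *)
  have QI i : \int[type_law (F i)]_x (\1_(E i) x * Q i x) =
      \int[joint_law F]_t (\1_(E i) (tnth t i) * u i t).
    rewrite (Rintegral_interim mu i (bounded_measurable_indic _ (mE i)) (bu i)).
    apply: ae_eq_Rintegral; [exact: bE|exact/bE/bounded_measurable_interim|].
    apply: filterS (pI i) => x Px; rewrite indicE.
    have [xE|xE] := boolP (x \in E i); last by rewrite !mul0r.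
    have Tx : type_space R x by apply: (hE i).2; rewrite -inE.
    rewrite !mul1r /Q patchE mem_set//.
    apply: EFin_inj; rewrite (Px Tx) /interim_expectation.
    rewrite -(integral_full_set mD (joint_law_profile_space hF)); last first.
      exact: bounded_measurable_resample.
    (* Overwriting one coordinate by a type in the unit interval stays in the profile space, where
       [u] and [p] agree. *)
    apply: eq_integral => t; rewrite inE => Dt; rewrite uD// => j.
    by rewrite tnth_mktuple; case: eqP => // _; exact: Dt.
  under eq_bigr => i _ do rewrite QI.
  rewrite -Rintegral_sum; last first.
    move=> i; apply: bounded_measurableM => //.
    exact/bounded_measurable_tnth/bounded_measurable_indic.
  apply: le_Rintegral => //.
  + apply/bounded_measurable_integrable/bounded_measurable_sum => i.
    apply: bounded_measurableM => //.
    exact/bounded_measurable_tnth/bounded_measurable_indic.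
  + exact/bounded_measurable_integrable/bounded_measurable_demand.
  move=> t _; have [Dt|Dt] := pselect (profile_space R n t); last first.
    rewrite big1 => [|i _]; last by rewrite uND// mulr0.
    rewrite le_min supply_ge0 andbT; apply: sumr_ge0 => i _.
    by rewrite mulr_ge0 ?indicE//; have /andP[] := capacity01 J i t.
  have [pH pJ] := pF _ Dt.
  have p01 i : 0 <= p i t <= 1 := (pA i).2 _ Dt.
  (* Pointwise, the units going to agents with types in [E] are limited by eligibility and by
     supply. *)
  rewrite le_min; apply/andP; split.
    apply: ler_sum => i _; rewrite ler_wpM2l ?indicE// uD// capacity_mk//.
    have /andP[p0 p1] := p01 i; have [//|iJ] := boolP (i \in J t).
    by rewrite leNgt; apply: contra iJ; exact: pJ.
  rewrite supply_mk//; apply: le_trans pH; apply: ler_sum => i _.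
  rewrite uD// indicE; have /andP[p0 _] := p01 i.
  by case: (_ \in E i); rewrite ?mul1r ?mul0r.
have [p [mp pcap pH] Qle] : exists2 p, allocations (capacity J) (supply h) p &
    forall i, {ae mu i, forall x, Q i x <= interim mu i (p i) x}.
  apply: allocation_interim_dominates => //.
  - exact: capacity01.
  - exact: supply_ge0.
  - exact: measurable_supply.
  - by move=> i; exact: measurable_capacity.
  (* The hypothesis covers only subsets of the type space. Intersecting with it keeps the left side,
     as [Q] vanishes outside, and can only lower the demand. *)
  move=> E mE; pose E' i := E i `&` type_space R.
  have mE' i : measurable (E' i) by exact: measurableI.
  have := hall E' (fun i => conj (mE' i) (@subIsetr _ _ _)).
  under eq_bigr => i _ do rewrite (integral_interim_rule F i hP (mE i)).
  rewrite (integral_demand F mh mJ mE') sumEFin lee_fin => /le_trans; apply.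
  apply: le_Rintegral => //.
  - exact/bounded_measurable_integrable/bounded_measurable_demand.
  - exact/bounded_measurable_integrable/bounded_measurable_demand.
  move=> t _; rewrite le_min !ge_min lexx orbT andbT; apply/orP; left.
  apply: ler_sum => i _; rewrite ler_wpM2r//; last first.
    by rewrite !indicE in_setI ler_nat; case: (_ \in E i); case: (_ \in type_space R).
  by have /andP[] := capacity01 J i t.
have Kp : allocations (capacity J) (supply h) p by [].
have bp i : bounded_measurable (p i).
  exact: (bounded_measurable_allocation (capacity01 J) i Kp).
have A01 i x : 0 <= interim mu i (p i) x <= 1.
  exact: (interim01 mu (capacity01 J) i x Kp).
(* The quotient is 0 when both Q i x and the interim value vanish. *)
pose r i x := Q i x / Num.max (Q i x) (interim mu i (p i) x).
(* Because of the maximum, the ratio is at most 1 even on the null set where domination fails. *)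
have r01 i x : 0 <= r i x <= 1.
  have /andP[Q0 _] := Q01 i x; have /andP[A0 _] := A01 i x.
  have [m0|m0] := eqVneq (Num.max (Q i x) (interim mu i (p i) x)) 0.
    by rewrite /r m0 invr0 mulr0 lexx ler01.
  have m_gt0 : 0 < Num.max (Q i x) (interim mu i (p i) x).
    by rewrite lt0r m0 le_max Q0.
  rewrite divr_ge0 ?(ltW m_gt0)//= ler_pdivrMr// mul1r.
  by rewrite le_max lexx.
have br i : bounded_measurable (r i).
  apply: bounded_measurable01 => //; apply: measurable_ratio_max => //.
    exact: (bounded_measurable_interim mu i (bp i)).1.
  by move=> x; have /andP[] := Q01 i x.
(* A factor depending only on the agent's own type multiplies the interim value by the same
   factor. *)
pose p' i t := r i (tnth t i) * p i t.
have bp' i : bounded_measurable (p' i).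
  by apply: bounded_measurableM => //; exact: bounded_measurable_tnth.
have p'_le i t : 0 <= p' i t <= p i t.
  have /andP[r0 r1] := r01 i (tnth t i); have /andP[p0 _] := pcap i t.
  by rewrite mulr_ge0//= ler_piMl.
exists p'; split=> [i|t Dt|i].
- split=> [|t _]; first exact: measurable_funTS (bp' i).1.
  have /andP[-> p'p] := p'_le i t; have /andP[_ pc] := pcap i t.
  rewrite (le_trans p'p)// (le_trans pc)//.
  by have /andP[] := capacity01 J i t.
- split=> [|i p'0].
    rewrite -supply_mk//; apply: le_trans (pH t); apply: ler_sum => i _.
    by have /andP[] := p'_le i t.
  have : 0 < capacity J i t.
    have /andP[_ p'p] := p'_le i t; have /andP[_ pc] := pcap i t.
    exact: lt_le_trans p'0 (le_trans p'p pc).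
  by rewrite capacity_mk//; case: (i \in J t) => //; rewrite ltxx.
apply: filterS (Qle i) => x QA Tx.
rewrite /interim_expectation.
rewrite (integral_full_set mD (joint_law_profile_space hF)); last first.
  exact: bounded_measurable_resample.
congr _%:E; transitivity (r i x * interim mu i (p i) x).
  have -> : P i x = Q i x by rewrite /Q patchE mem_set.
  (* Domination holds at this [x], so the denominator is the interim value; if that is 0, then
     [Q i x] is 0 too. *)
  rewrite /r max_r//; have [A0|A0] := eqVneq (interim mu i (p i) x) 0.
    have /andP[Q0 _] := Q01 i x.
    by apply/eqP; rewrite A0 mulr0 eq_le Q0 -A0 QA.
  by rewrite divfK.
rewrite -RintegralZl//; last first.
  exact/bounded_measurable_integrable/bounded_measurable_resample.
by apply: eq_Rintegral => t _; rewrite /p' tnth_resample.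
Qed.
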